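(* Let $n\ge1$, $J\ge 1$, fix $\vec{p}=(p_1,\ldots,p_J)\in[0,1]^J$ and, for $j=1,\ldots,J$, fix a linear subspace $V_j^0\subset\mathbb{R}^n$ of dimension $n_j'$, with $n_j:=n-n_j'=\dim(V_j^0)^\perp$ and $1\le n_j\le n$; let $\pi_j^0$ be the orthogonal projection from $\mathbb{R}^n$ onto $(V_j^0)^\perp$. For $r\in\{1,\ldots,n\}$ let $\mathcal{J}_r=\{j\in\{1,\ldots,J\}:n_j\ge r\}$. Then there exist $\nu>0$ and $C_0>0$ such that \[ \underline{\mathrm{BL}}(\vec{\pi},\vec{p},R)\le C_0\,R^{\sum_{r=1}^n\max\left(1-\sum_{j\in\mathcal{J}_r}p_j,\;0\right)} \] holds for all $R\ge 1$ and all tuples $\vec{\pi}=(\pi_1,\ldots,\pi_J)$ of orthogonal projections $\pi_j:\mathbb{R}^n\to V_j^\perp$, where $V_j$ is an $n_j'$-dimensional linear subspace of $\mathbb{R}^n$ which is within a distance $\nu$ of $V_j^0$.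
   Context: For $R>0$, $\vec{p}\in[0,1]^J$ and a $J$-tuple $\vec{\pi}=(\pi_j)$ of linear maps $\pi_j:\mathbb{R}^n\to\mathbb{R}^{n_j}$, the regularized Brascamp–Lieb constant is \[\underline{\mathrm{BL}}(\vec{\pi},\vec{p},R):=\sup_{\vec{f}}\frac{\int_{[-R,R]^n}\prod_{j=1}^Jf_j(\pi_j(\mathbf{x}))^{p_j}\,d\mathbf{x}}{\prod_{j=1}^J\left(\int_{\mathbb{R}^{n_j}}f_j(\mathbf{x}_j)\,d\mathbf{x}_j\right)^{p_j}},\] where the supremum is over all $\vec{f}=(f_1,\ldots,f_J)$ with each $f_j\in L^1(\mathbb{R}^{n_j})$ nonzero, nonnegative, and constant on each cube $\mathbf{v}+[0,1)^{n_j}$, $\mathbf{v}\in\mathbb{Z}^{n_j}$. When $\pi_j$ is an orthogonal projection onto an $n_j$-dimensional subspace $V_j^\perp$ of $\mathbb{R}^n$, the space $V_j^\perp$ (with the metric induced from $\mathbb{R}^n$) is identified with $\mathbb{R}^{n_j}$ by a linear isometry; the bound is for any such identification. The distance between $n_j'$-dimensional subspaces is the standard metric on the Grassmann manifold of $n_j'$-dimensional subspaces of $\mathbb{R}^n$ (for instance $d(V,W)=\|P_V-P_W\|$ with $P_V,P_W$ the orthogonal projections and $\|\cdot\|$ the operator norm). *)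

(* Defs.v *)
From HB Require Import structures.
From mathcomp Require Import all_boot all_order all_algebra.
From mathcomp Require Import all_classical all_reals all_analysis.

Set Implicit Arguments.
Unset Strict Implicit.
Unset Printing Implicit Defensive.

Import Order.TTheory GRing.Theory Num.Theory.
Import numFieldNormedType.Exports.

Local Open Scope classical_set_scope.
Local Open Scope ring_scope.

(* Canonical inference does not find this: the instances on m1 \x m2 for
   subprobabilities hide the sigma-finite one. *)
Lemma sigma_finite_product d1 d2 (T1 : measurableType d1)
    (T2 : measurableType d2) (R : realType)
    (m1 : {sigma_finite_measure set T1 -> \bar R})
    (m2 : {sigma_finite_measure set T2 -> \bar R}) :
  sigma_finite setT (m1 \x m2)%E.
Proof.
have /sigma_finiteP[F [TF ndF Foo]] := sigma_finiteT m1.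
have /sigma_finiteP[G [TG ndG Goo]] := sigma_finiteT m2.
exists (fun n => F n `*` G n).
  rewrite -setXTT TF TG predeqE => -[x y]; split.
    move=> [/= [n _ Fnx] [k _ Gky]]; exists (maxn n k) => //; split.
    - by move: x Fnx; exact/subsetPset/ndF/leq_maxl.
    - by move: y Gky; exact/subsetPset/ndG/leq_maxr.
  by move=> [n _ []/= ? ?]; split; exists n.
move=> k; have [? ?] := Foo k; have [? ?] := Goo k.
split; first exact: measurableX.
by rewrite product_measure1E// lte_mul_pinfty// ge0_fin_numE.
Qed.

Section lebesgue_tuple_succ.
Context {R : realType}.
Local Notation T := (measurableTypeR R).
Variables (n : nat) (mu : {sigma_finite_measure set (n.-tuple T) -> \bar R}).

Definition tuple_cons (x : T * n.-tuple T) : n.+1.-tuple T :=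
  [the n.+1.-tuple T of x.1 :: x.2].

Lemma measurable_tuple_cons : measurable_fun [set: T * n.-tuple T] tuple_cons.
Proof. exact: measurable_cons. Qed.

Lemma measurable_tuple_uncons : measurable_fun [set: n.+1.-tuple T]
  (fun t : n.+1.-tuple T => (thead t, [tuple of behead t])).
Proof.
apply/measurable_fun_pairP; split.
  exact: measurable_tnth.
exact: measurable_behead.
Qed.

Definition lebesgue_tuple_succ : set (n.+1.-tuple T) -> \bar R :=
  pushforward (lebesgue_measure \x mu)%E tuple_cons.

Let mf := measurable_tuple_cons.

Let succ0 : lebesgue_tuple_succ set0 = 0%E. Proof. exact: measure0. Qed.

Let succ_ge0 A : (0 <= lebesgue_tuple_succ A)%E. Proof. exact: measure_ge0. Qed.

Let succ_sigma_additive : semi_sigma_additive lebesgue_tuple_succ.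
Proof. exact: measure_semi_sigma_additive. Qed.

HB.instance Definition _ := isMeasure.Build _ _ _ lebesgue_tuple_succ
  succ0 succ_ge0 succ_sigma_additive.

Let succ_sigma_finite : sigma_finite setT lebesgue_tuple_succ.
Proof.
have [F FT Ffin] := sigma_finite_product lebesgue_measure mu.
pose u (t : n.+1.-tuple T) := (thead t, [tuple of behead t]).
exists (fun k => u @^-1` F k).
  by rewrite -preimage_bigcup -FT preimage_setT.
move=> k; have [mFk Fkfin] := Ffin k; split.
  by rewrite -[X in measurable X]setTI; exact: measurable_tuple_uncons.
rewrite /lebesgue_tuple_succ /pushforward -comp_preimage.
suff -> : u \o tuple_cons = id by [].
apply/funext => -[x t] /=; rewrite /u; congr pair; exact/val_inj.
Qed.

HB.instance Definition _ := Measure_isSigmaFinite.Build _ _ _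
  lebesgue_tuple_succ succ_sigma_finite.

End lebesgue_tuple_succ.

(* Lebesgue measure on R^n: the n-fold product of lebesgue_measure, each step
   transported along the bijection tuple_cons : R * R^n -> R^(n+1). *)
Fixpoint lebesgue_tuple (R : realType) (n : nat) :
    {sigma_finite_measure set (n.-tuple (measurableTypeR R)) -> \bar R} :=
  match n with
  | 0 => \d_([tuple] : 0.-tuple (measurableTypeR R))
  | n'.+1 => lebesgue_tuple_succ (lebesgue_tuple R n')
  end.


Lemma lebesgue_tuple_box (R : realType) (n : nat)
    (A : 'I_n -> set (measurableTypeR R)) (mA : forall i, measurable (A i)) :
  lebesgue_tuple R n [set t | forall i, A i (tnth t i)] =
  (\prod_(i < n) lebesgue_measure (A i))%E.
Proof.
elim: n A mA => [|n IHn] A mA.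
  rewrite big_ord0 /= diracE mem_set//=.
  by move=> -[].
rewrite big_ord_recl -IHn//= /lebesgue_tuple_succ /pushforward.
rewrite -product_measure1E//; last first.
  rewrite (_ : [set t | _] = \bigcap_(i in [set: 'I_n])
    ((@tnth n (measurableTypeR R)) ^~ i @^-1` A (lift ord0 i))).
    apply: fin_bigcap_measurable => // i _.
    by rewrite -[X in measurable X]setTI; exact: measurable_tnth.
  by apply/seteqP; split => [t tA i _|t tA i]; exact: tA.
congr (_ _); apply/seteqP; split => [[x t] /= tA|[x t] /= [xA tA] i].
  split; first exact: (tA ord0).
  by move=> i; move: (tA (lift ord0 i)); rewrite /tuple_cons tnthS.
by rewrite /tuple_cons; case: (unliftP ord0 i) => [j|] -> //; rewrite tnthS.
Qed.

Definition rV_of_tuple (R : realType) (n : nat)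
    (t : n.-tuple (measurableTypeR R)) : 'rV[R]_n := \row_i tnth t i.

(* The unit cube v + [0, 1)^m. *)
Definition unit_cube (R : realType) (m : nat) (v : 'rV[int]_m) : set 'rV[R]_m :=
  [set x | forall i, (v 0 i)%:~R <= x 0 i < (v 0 i)%:~R + 1].

Definition cube_constant (R : realType) (m : nat) (f : 'rV[R]_m -> R) : Prop :=
  forall (v : 'rV[int]_m) (x y : 'rV[R]_m),
    unit_cube v x -> unit_cube v y -> f x = f y.

(* The functions allowed in the supremum. As f is constant on unit cubes, being
   nonzero somewhere is the same as being nonzero as an element of L^1. *)
Definition BL_input (R : realType) (m : nat) (f : 'rV[R]_m -> R) : Prop :=
  [/\ (lebesgue_tuple R m).-integrable setT (EFin \o f \o @rV_of_tuple R m),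
      forall x, 0 <= f x,
      exists x, f x != 0 &
      cube_constant f].

Definition centered_cube (R : realType) (n : nat) (r : R) : set 'rV[R]_n :=
  [set x | forall i, - r <= x 0 i <= r].

Section regularized_BL.
Variables (R : realType) (n J : nat) (m : 'I_J -> nat).
Variables (pi : forall j : 'I_J, {linear 'rV[R]_n -> 'rV[R]_(m j)}).
Variables (p : 'I_J -> R) (r : R).

(* When p j = 0, the library convention 0 `^ 0 = 1 makes the j-th factor 1. *)
Definition BL_num (f : forall j : 'I_J, 'rV[R]_(m j) -> R) : \bar R :=
  (\int[lebesgue_tuple R n]_(t in @rV_of_tuple R n @^-1` centered_cube r)
     (\prod_(j < J) f j (pi j (rV_of_tuple t)) `^ p j)%:E)%E.

Definition BL_den (f : forall j : 'I_J, 'rV[R]_(m j) -> R) : R :=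
  \prod_(j < J)
    (\int[lebesgue_tuple R (m j)]_t f j (rV_of_tuple t)) `^ p j.

Definition regularized_BL : \bar R :=
  ereal_sup [set (BL_num f / (BL_den f)%:E)%E | f in
    [set f : forall j : 'I_J, 'rV[R]_(m j) -> R | forall j, BL_input (f j)]].

End regularized_BL.

(* The library norm on 'rV[R]_n is the sup norm, hence this definition. *)
Definition euclidean_norm (R : realType) (n : nat) (x : 'rV[R]_n) : R :=
  Num.sqrt (\sum_i x 0 i ^+ 2).

Definition operator_norm (R : realType) (n : nat) (A : 'M[R]_n) : R :=
  sup [set euclidean_norm (x *m A) | x in [set x | euclidean_norm x <= 1]].

(* A linear subspace of R^n is represented by the row space of a matrix. *)
Definition orthocomp (R : realType) (n : nat) (V : 'M[R]_n) : 'M[R]_n :=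
  orthomx idfun 1%:M V.

(* Acts on row vectors, x |-> x *m orthogonal_projection V. *)
Definition orthogonal_projection (R : realType) (n : nat) (V : 'M[R]_n) :
    'M[R]_n :=
  proj_mx V (orthocomp V).

Definition subspace_dist (R : realType) (n : nat) (V W : 'M[R]_n) : R :=
  operator_norm (orthogonal_projection V - orthogonal_projection W).

(* pi is the orthogonal projection of R^n onto the row space of W, followed by
   a linear isometry phi of that space with R^m; when W has rank m, such a phi
   is automatically onto. Values of phi off the row space of W are irrelevant. *)
Definition orthogonal_projection_onto (R : realType) (n m : nat) (W : 'M[R]_n)
    (pi : {linear 'rV[R]_n -> 'rV[R]_m}) : Prop :=
  exists phi : {linear 'rV[R]_n -> 'rV[R]_m},
    (forall x : 'rV[R]_n, (x <= W)%MS ->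
       euclidean_norm (phi x) = euclidean_norm x) /\
    (forall x : 'rV[R]_n, pi x = phi (x *m orthogonal_projection W)).

(* Main.v *)
Require Import Defs.
From mathcomp Require Import all_boot all_order all_algebra.
From mathcomp Require Import all_classical all_reals all_analysis.
From mathcomp Require Import measurable_realfun ring lra.

(** The bound is Hoelder's inequality on the cube [-r, r]^n, after the exponents
    p have been lowered to a tuple q of total mass at most 1.

    Write F_j for the integral of f_j and n_j for the dimension of its domain.
    A function constant on unit cubes is bounded by its integral
    ([BL_input_le_integral]), so f_j^p_j <= F_j^(p_j - q_j) f_j^q_j whenever
    0 <= q_j <= p_j: lowering an exponent costs nothing. On the other side, the
    exponent of r only sees the numbers min(1, s_k), where s_k is the sum of the
    p_j with n_j >= k, because max(1 - s_k, 0) = 1 - min(1, s_k). One can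
    therefore discard mass from the smallest dimensions, until the total is at
    most 1, without changing the exponent ([truncated_weights]). For the
    resulting q the exponent becomes linear: it is n - sum_j q_j n_j
    ([BL_weights]).

    When sum_j q_j <= 1, Hoelder's inequality with exponents q_j, completed by
    the constant function 1 with exponent 1 - sum_j q_j, reduces everything to
    one map at a time, namely to
      int_{[-r, r]^n} f_j(pi_j x) dx <= C_j r^(n - n_j) F_j,
    and the powers of r add up to n - sum_j q_j n_j. Here it is applied in the
    form of the pointwise weighted inequality between the arithmetic and the
    geometric mean ([weighted_AMGM], [BL_integrand_le]), which is then
    integrated ([regularized_BL_le]).

    The estimate for one map follows by cutting R^(n_j) into unit cubes, on
    which f_j is constant, once the part of [-r, r]^n that pi_j sends into a
    given unit cube is known to have measure O(r^(n - n_j))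
    ([lebesgue_tuple_cube_preimage_le]). For that, choose n_j rows of the matrix
    of pi_j^0 that are linearly independent. The corresponding n_j coordinates
    of x are then determined by pi_j^0 x and the other n - n_j coordinates, with
    a Lipschitz bound that survives a small perturbation of the projection
    ([projection_controls_coords]); this is where nu comes from. Hence the
    n - n_j free coordinates, located up to an error 1, confine x to a box of
    bounded size, and there are O(r^(n - n_j)) choices for them. *)

Set Implicit Arguments.
Unset Strict Implicit.
Unset Printing Implicit Defensive.

Import Order.TTheory GRing.Theory Num.Theory.
Import numFieldNormedType.Exports.

Local Open Scope classical_set_scope.
Local Open Scope ring_scope.

(** * Orthogonal projections and control of coordinates *)

Lemma orthocompP (R : realType) n (V : 'M[R]_n) m (x : 'M[R]_(m, n)) :
  (x <= orthocomp V)%MS = (x *m V^T == 0).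
Proof.
rewrite /orthocomp /orthomx sub_kermx mul1mx.
congr (x *m _ == 0); by apply/matrixP => i j; rewrite !mxE.
Qed.

Lemma mulmx_tr_eq0 (R : realType) n (x : 'rV[R]_n) : x *m x^T = 0 -> x = 0.
Proof.
move=> /matrixP/(_ 0 0); rewrite !mxE => /eqP.
rewrite psumr_eq0 => [/allP xx|i _]; last by rewrite mxE -expr2 sqr_ge0.
apply/rowP => i; have := xx i (mem_index_enum _).
by rewrite !mxE -expr2 sqrf_eq0 => /eqP.
Qed.

Lemma cap_orthocomp (R : realType) n (V : 'M[R]_n) :
  (V :&: orthocomp V)%MS = 0.
Proof.
apply/eqP; rewrite -submx0; apply/rV_subP => x.
rewrite sub_capmx orthocompP => /andP[/submxP[y xy] /eqP xV].
suff -> : x = 0 by exact: sub0mx.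
by apply: mulmx_tr_eq0; rewrite {2}xy trmx_mul mulmxA xV mul0mx.
Qed.

Lemma rank_orthocomp (R : realType) n (V : 'M[R]_n) :
  \rank (orthocomp V) = (n - \rank V)%N.
Proof.
rewrite /orthocomp /orthomx mul1mx mxrank_ker -[in RHS]mxrank_tr.
congr (n - \rank _)%N; by apply/matrixP => i j; rewrite !mxE.
Qed.

Lemma add_orthocomp (R : realType) n (V : 'M[R]_n) :
  (1%:M <= V + orthocomp V)%MS.
Proof.
rewrite sub1mx /row_full -(eqn_add2r (\rank (V :&: orthocomp V))).
rewrite mxrank_sum_cap rank_orthocomp cap_orthocomp mxrank0 addn0.
by rewrite subnKC ?rank_leq_row.
Qed.

Lemma sub_orthocompK (R : realType) n (V : 'M[R]_n) :
  (V <= orthocomp (orthocomp V))%MS.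
Proof.
rewrite orthocompP -trmx_eq0 trmx_mul trmxK.
by have := submx_refl (orthocomp V); rewrite orthocompP.
Qed.

(** Turns closeness of the subspaces V_j, in which the distance is measured, into
    closeness of the projections onto their orthogonal complements. *)
Lemma orthogonal_projection_orthocomp (R : realType) n (V : 'M[R]_n) :
  orthogonal_projection (orthocomp V) = 1%:M - orthogonal_projection V.
Proof.
have := add_proj_mx (cap_orthocomp V) (add_orthocomp V).
rewrite !mul1mx -/(orthogonal_projection V).
set P := orthogonal_projection V; set Q := proj_mx (orthocomp V) V => PQ.
rewrite -[LHS]mul1mx -PQ mulmxDl addrAC subrr add0r.
rewrite -[P]mul1mx -[X in _ + X *m _]mul1mx.
rewrite proj_mx_0 ?cap_orthocomp ?add0r//; last first.
  exact: submx_trans (proj_mx_sub _ _ _) (sub_orthocompK _).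
by rewrite /orthogonal_projection proj_mx_id ?cap_orthocomp ?proj_mx_sub ?mul1mx.
Qed.

Lemma rank_orthogonal_projection (R : realType) n (W : 'M[R]_n) :
  \rank (orthogonal_projection W) = \rank W.
Proof.
apply/eqP; rewrite eqn_leq; apply/andP; split.
  by rewrite -[orthogonal_projection W]mul1mx mxrankS ?proj_mx_sub.
rewrite -{1}(proj_mx_id (cap_orthocomp W) (submx_refl W)).
exact: mxrankM_maxr.
Qed.

Lemma coord_le_euclidean_norm (R : realType) n (x : 'rV[R]_n) i :
  `|x 0 i| <= euclidean_norm x.
Proof.
rewrite -sqrtr_sqr /euclidean_norm ler_wsqrtr// (bigD1 i)//= lerDl.
by apply: sumr_ge0 => j _; exact: sqr_ge0.
Qed.

Lemma euclidean_norm_le (R : realType) n (x : 'rV[R]_n) (M : R) :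
  0 <= M -> (forall i, `|x 0 i| <= M) -> euclidean_norm x <= n%:R * M.
Proof.
move=> M0 xM.
have nM0 : 0 <= n%:R * M by rewrite mulr_ge0.
rewrite -(ger0_norm nM0) -sqrtr_sqr /euclidean_norm ler_wsqrtr//.
apply: (@le_trans _ _ (\sum_(i < n) M ^+ 2)).
  apply: ler_sum => i _; rewrite -(real_normK (num_real _)).
  by rewrite lerXn2r ?nnegrE.
rewrite sumr_const card_ord exprMn -[_ *+ n]mulr_natl ler_wpM2r ?sqr_ge0//.
by rewrite -natrX ler_nat; case: n {x xM nM0} => // n; rewrite -{1}[n.+1]expn1 leq_pexp2l.
Qed.

Lemma euclidean_norm0 (R : realType) n : euclidean_norm (0 : 'rV[R]_n) = 0.
Proof.
by rewrite /euclidean_norm big1 ?sqrtr0// => i _; rewrite mxE expr0n.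
Qed.

Lemma euclidean_normZ (R : realType) n (a : R) (x : 'rV[R]_n) :
  euclidean_norm (a *: x) = `|a| * euclidean_norm x.
Proof.
rewrite -sqrtr_sqr -sqrtrM ?sqr_ge0// /euclidean_norm mulr_sumr.
by congr Num.sqrt; apply: eq_bigr => i _; rewrite mxE exprMn.
Qed.

Definition entry_sum (R : realType) m n (A : 'M[R]_(m, n)) : R :=
  \sum_i \sum_j `|A i j|.

Lemma entry_sum_ge0 (R : realType) m n (A : 'M[R]_(m, n)) : 0 <= entry_sum A.
Proof. by apply: sumr_ge0 => i _; apply: sumr_ge0. Qed.

Lemma coord_mulmx_le (R : realType) m n (x : 'rV[R]_m) (A : 'M[R]_(m, n)) (M : R) :
  (forall i, `|x 0 i| <= M) -> forall j, `|(x *m A) 0 j| <= M * entry_sum A.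
Proof.
move=> xM j; rewrite mxE (le_trans (ler_norm_sum _ _ _))// mulr_sumr ler_sum//.
move=> i _; rewrite normrM ler_pM// (bigD1 j)//= lerDl; exact: sumr_ge0.
Qed.

Lemma euclidean_norm_mulmx_le (R : realType) n (A : 'M[R]_n) (x : 'rV[R]_n) :
  euclidean_norm (x *m A) <= operator_norm A * euclidean_norm x.
Proof.
have [->|x0] := eqVneq x 0; first by rewrite mul0mx !euclidean_norm0 mulr0.
have nx0 : 0 < euclidean_norm x.
  case/rV0Pn : x0 => i xi; apply: lt_le_trans (coord_le_euclidean_norm x i).
  by rewrite normr_gt0.
rewrite -ler_pdivrMr// mulrC -[X in X * _]ger0_norm ?invr_ge0 ?(ltW nx0)//.
rewrite -euclidean_normZ scalemxAl; apply: sup_upper_bound; last first.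
  exists ((euclidean_norm x)^-1 *: x) => //=; rewrite euclidean_normZ.
  by rewrite ger0_norm ?invr_ge0 ?(ltW nx0)// mulVf ?gt_eqF.
split; first by exists 0; exists 0 => /=; rewrite ?mul0mx euclidean_norm0.
exists (n%:R * (1 * entry_sum A)) => _ [y /= y1 <-].
apply: euclidean_norm_le; first by rewrite mul1r entry_sum_ge0.
apply: coord_mulmx_le => i; exact: le_trans (coord_le_euclidean_norm _ _) y1.
Qed.

(** The coordinates in the range of I are those of d independent rows of the
    projection onto the orthogonal complement of V0, so they can be solved for
    in terms of the image of z and of its remaining coordinates. Replacing V0 by
    V adds to this solution an error of at most half the largest coordinate of
    z, which is absorbed. *)
Lemma projection_controls_coords (R : realType) n d (V0 : 'M[R]_n) :
  (n - \rank V0)%N = d ->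
  exists (I : 'I_d -> 'I_n) (nu K : R),
    [/\ injective I, 0 < nu, 0 <= K &
    forall V (pi : {linear 'rV[R]_n -> 'rV[R]_d}),
      subspace_dist V V0 <= nu ->
      orthogonal_projection_onto (orthocomp V) pi ->
      forall z : 'rV[R]_n,
        (forall i, i \notin codom I -> `|z 0 i| <= 1) ->
        (forall a, `|pi z 0 a| <= 1) ->
        forall i, `|z 0 i| <= K].
Proof.
pose P0 := orthogonal_projection (orthocomp V0).
rewrite -rank_orthocomp -rank_orthogonal_projection -/P0 => rP0.
have [I Iinj /row_freeP[D ID]] : exists2 I : 'I_d -> 'I_n, injective I &
    row_free (rowsub I P0).
  case: d / rP0; exists (maxrankfun P0) => //; first exact: maxrankfun_inj.
  exact: maxrowsub_free.
pose S : 'M[R]_(d, n) := rowsub I 1%:M.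
pose c := entry_sum D; have c0 : 0 <= c := entry_sum_ge0 D.
pose b := entry_sum P0; have b0 : 0 <= b := entry_sum_ge0 P0.
(* At this distance the perturbation term nu * n * c below is at most 1/2. *)
pose nu := (2 * n.+1%:R * (c + 1))^-1.
have nu0 : 0 < nu by rewrite invr_gt0 !mulr_gt0// ltr_wpDl.
exists I, nu, (2 + 2 * (d%:R + b) * c); split => //.
  have : 0 <= 2 * (d%:R + b) * c by rewrite !mulr_ge0// addr_ge0.
  lra.
move=> V pi VV0 [phi [phi_iso piE]] z z1 piz1 i.
set P := orthogonal_projection (orthocomp V) in phi_iso piE.
pose zI : 'rV[R]_d := \row_a z 0 (I a).
pose z' : 'rV[R]_n := z - zI *m S.
pose N : R := \big[Num.max/0]_j `|z 0 j|.
have zN j : `|z 0 j| <= N by exact: le_bigmax.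
have N0 : 0 <= N by exact: bigmax_ge_id.
have zIS j : (zI *m S) 0 j = if j \in codom I then z 0 j else 0.
  rewrite mxE; case: ifPn => [/codomP[a ->]|jI].
    rewrite (bigD1 a)//= !mxE eqxx mulr1 big1 ?addr0// => e ea.
    by rewrite !mxE (inj_eq Iinj) (negbTE ea) mulr0.
  rewrite big1// => e _; rewrite !mxE; case: eqP => [Iej|_]; last by rewrite mulr0.
  by move/negP : jI; case; rewrite -Iej codom_f.
have z'1 j : `|z' 0 j| <= 1.
  rewrite mxE [X in _ + X]mxE zIS; case: ifPn => [_|/z1]; last by rewrite subr0.
  by rewrite subrr normr0.
have zP : euclidean_norm (z *m P) <= d%:R * 1.
  by rewrite -phi_iso ?proj_mx_sub// -piE euclidean_norm_le.
(* z = zI *m S + z', and D is a right inverse of the rows S *m P0. *)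
have zIE : zI = (z *m P + z *m (P0 - P) - z' *m P0) *m D.
  rewrite mulmxBr addrC [in X in _ + X]addrC subrK addrC -mulmxBl opprB addrC subrK.
  by rewrite -(mulmxA zI) /S -rowsubE -mulmxA ID mulmx1.
have zPP j : `|(z *m (P0 - P)) 0 j| <= nu * (n%:R * N).
  apply: le_trans (coord_le_euclidean_norm _ _) _.
  apply: le_trans (euclidean_norm_mulmx_le _ _) _.
  have -> : P0 - P = orthogonal_projection V - orthogonal_projection V0.
    by rewrite /P0 /P !orthogonal_projection_orthocomp opprB addrC addrA subrK.
  apply: le_trans (ler_wpM2r (sqrtr_ge0 _) VV0) _.
  by rewrite ler_wpM2l ?(ltW nu0)// euclidean_norm_le.
have zIle a : `|zI 0 a| <= (d%:R + nu * (n%:R * N) + b) * c.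
  rewrite zIE; apply: coord_mulmx_le => {}i.
  have -> (A B C : 'rV[R]_n) : (A + B - C) 0 i = A 0 i + B 0 i - C 0 i.
    by rewrite !mxE.
  rewrite (le_trans (ler_normB _ _))// lerD//.
    rewrite (le_trans (ler_normD _ _))// lerD//.
      by rewrite (le_trans (coord_le_euclidean_norm _ _))// (le_trans zP)// mulr1.
  by rewrite -[leRHS]mul1r; exact: coord_mulmx_le.
have nunc : nu * n%:R * c <= 1 / 2.
  rewrite -mulrA mulrC ler_pdivrMr ?mulr_gt0// ?ltr_wpDl//.
  have : n%:R * c <= n.+1%:R * (c + 1).
    by rewrite ler_pM// ?lerDl// ler_nat.
  lra.
(* The largest coordinate N occurs on both sides, with factor 1/2 on the right. *)
have NK : N <= 1 + ((d%:R + b) * c + N / 2).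
  have dbc0 : 0 <= (d%:R + b) * c by rewrite mulr_ge0// addr_ge0.
  apply/bigmax_leP; split => [|j _]; first lra.
  have [/codomP[a ->]|/z1] := boolP (j \in codom I); last lra.
  have := zIle a; rewrite mxE => zIa.
  have : N * (nu * n%:R * c) <= N * (1 / 2) by exact: ler_wpM2l.
  lra.
apply: le_trans (zN i) _; lra.
Qed.

(** * Preimages of unit cubes under a linear map *)

Lemma rV_of_tupleE (R : realType) n (t : n.-tuple (measurableTypeR R)) i :
  rV_of_tuple t 0 i = tnth t i.
Proof. by rewrite mxE. Qed.

(** The ambient type for measurability is that of tuples, so a linear map is
    handled through its coordinates, which are finite sums of projections. *)
Lemma measurable_linear_coord (R : realType) n d
    (f : {linear 'rV[R]_n -> 'rV[R]_d}) i :
  measurable_fun setT (fun t => f (@rV_of_tuple R n t) 0 i).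
Proof.
rewrite (_ : (fun _ => _) = fun t => \sum_j tnth t j * lin1_mx f j i).
  apply: measurable_sum => j; apply: measurable_funM => //.
  exact: measurable_tnth.
apply/funext => t; rewrite -mul_rV_lin1 mxE.
by apply: eq_bigr => j _; rewrite rV_of_tupleE.
Qed.

Lemma measurable_preimage_coords (R : realType) n d
    (f : {linear 'rV[R]_n -> 'rV[R]_d}) (A : 'I_d -> set R) :
  (forall i, measurable (A i)) ->
  measurable (@rV_of_tuple R n @^-1` [set x | forall i, A i (f x 0 i)]).
Proof.
move=> mA.
rewrite (_ : _ @^-1` _ = \bigcap_(i in [set: 'I_d])
    ((fun t => f (@rV_of_tuple R n t) 0 i) @^-1` A i)).
  apply: fin_bigcap_measurable => // i _.
  by rewrite -[X in measurable X]setTI; exact: measurable_linear_coord.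
by apply/seteqP; split => [t tA i _|t tA i]; exact: tA.
Qed.

Lemma measurable_preimage_unit_cube (R : realType) n d
    (f : {linear 'rV[R]_n -> 'rV[R]_d}) (v : 'rV[int]_d) :
  measurable (@rV_of_tuple R n @^-1` (f @^-1` unit_cube v)).
Proof.
apply: (measurable_preimage_coords f
  (A := fun i => [set y | (v 0 i)%:~R <= y < (v 0 i)%:~R + 1])) => i.
by rewrite (_ : [set _ | _] = [set` `[(v 0 i)%:~R, (v 0 i)%:~R + 1[%R])//.
Qed.

Lemma measurable_centered_cube (R : realType) n (r : R) :
  measurable (@rV_of_tuple R n @^-1` centered_cube r).
Proof.
apply: (measurable_preimage_coords idfun
  (A := fun i => [set y | - r <= y <= r])) => i.
by rewrite (_ : [set _ | _] = [set` `[- r, r]%R])//.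
Qed.

Lemma lebesgue_tuple_closed_box (R : realType) n (c : 'I_n -> R) (k : R) :
  0 <= k ->
  measurable [set t : n.-tuple (measurableTypeR R) |
    forall i, c i - k <= tnth t i <= c i + k] /\
  lebesgue_tuple R n [set t | forall i, c i - k <= tnth t i <= c i + k] =
  ((2 * k) ^+ n)%:E.
Proof.
move=> k0.
have AE i : [set y | c i - k <= y <= c i + k] =
    [set` `[c i - k, c i + k]%R].
  by apply/seteqP; split => y /=; rewrite in_itv.
have mA i : measurable ([set y | c i - k <= y <= c i + k] : set R).
  by rewrite AE.
split.
  have := @measurable_preimage_coords R n n idfun _ mA.
  rewrite (_ : _ @^-1` _ = [set t | forall i, c i - k <= tnth t i <= c i + k])//.
  apply/seteqP; split=> t /= tA i; have := tA i; by rewrite rV_of_tupleE.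
rewrite (@lebesgue_tuple_box R n (fun i => [set y | c i - k <= y <= c i + k]))//.
rewrite (eq_bigr (fun=> (2 * k)%:E)) => [|i _].
  by rewrite prodEFin prodr_const card_ord.
rewrite AE lebesgue_measure_itv/= lte_fin ltrD2l; case: ifPn => kk.
  by rewrite -EFinB; congr EFin; ring.
by congr EFin; move: kk; rewrite -leNgt; lra.
Qed.

Lemma lebesgue_tuple_unit_cube (R : realType) d (v : 'rV[int]_d) :
  lebesgue_tuple R d (@rV_of_tuple R d @^-1` unit_cube v) = 1%E.
Proof.
have AE i : [set y : R | (v 0 i)%:~R <= y < (v 0 i)%:~R + 1] =
    [set` `[(v 0 i)%:~R, (v 0 i)%:~R + 1[%R].
  by apply/seteqP; split => y /=; rewrite in_itv.
rewrite (_ : _ @^-1` _ = [set t | forall i,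
    [set y : R | (v 0 i)%:~R <= y < (v 0 i)%:~R + 1] (tnth t i)]).
  rewrite (@lebesgue_tuple_box R d (fun i =>
    [set y | (v 0 i)%:~R <= y < (v 0 i)%:~R + 1])) => [|i]; last by rewrite AE.
  rewrite big1// => i _; rewrite AE lebesgue_measure_itv/= lte_fin.
  by rewrite ltrDl ltr01 -EFinB addrAC subrr add0r.
by apply/seteqP; split=> t /= tA i; have := tA i; rewrite rV_of_tupleE.
Qed.

(** Sort the points of the set by the integer parts of their coordinates outside
    the range of I. Two points in the same class satisfy the hypotheses of the
    control property, applied to their difference, so a class lies in a box of
    half-width K around any of its points, and there are at most (4 r)^(n - d)
    classes. *)
Lemma lebesgue_tuple_cube_preimage_le (R : realType) n d (I : 'I_d -> 'I_n)
    (K : R) (pi : {linear 'rV[R]_n -> 'rV[R]_d}) :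
  injective I -> 0 <= K ->
  (forall z : 'rV[R]_n,
     (forall i, i \notin codom I -> `|z 0 i| <= 1) ->
     (forall a, `|pi z 0 a| <= 1) ->
     forall i, `|z 0 i| <= K) ->
  forall (r : R) (v : 'rV[int]_d), 1 <= r ->
  (lebesgue_tuple R n (@rV_of_tuple R n @^-1`
     (centered_cube r `&` (pi @^-1` unit_cube v))) <=
   ((2 * K) ^+ n * 4 ^+ (n - d) * r ^+ (n - d))%:E)%E.
Proof.
move=> Iinj K0 piK r v r1.
set E := _ @^-1` _.
(* M is 2 N, written as a successor so that 'I_M is visibly inhabited. *)
pose N := (Num.truncn r).+1; pose M := (N.*2.-1).+1.
pose T := {i : 'I_n | i \notin codom I}.
(* Adding N > r makes the coordinates positive, so that the integer parts are
   naturals below 2 N. *)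
pose c (t : n.-tuple (measurableTypeR R)) (i : T) :=
  Num.truncn (tnth t (val i) + N%:R).
pose E_ (g : {ffun T -> 'I_M}) := E `&` [set t | forall i, c t i = g i].
(* A point of the class g; an arbitrary one when the class is empty, which
   only adds one more box of the same measure. *)
pose t_ g := xget [tuple of nseq n 0] (E_ g).
pose B_ g := [set t : n.-tuple (measurableTypeR R) |
  forall i, tnth (t_ g) i - K <= tnth t i <= tnth (t_ g) i + K].
pose g0 : {ffun T -> 'I_M} := [ffun=> ord0].
have NR : r < N%:R by exact: truncnS_gt.
have ME : M%:R = 2 * N%:R :> R by rewrite /M prednK ?double_gt0// -mul2n natrM.
have cE t i : E t -> (c t i)%:R <= tnth t (val i) + N%:R < (c t i).+1%:R.
  move=> [/(_ (val i))/=]; rewrite rV_of_tupleE => /andP[tr1 tr2] _.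
  by apply: truncn_itv; lra.
have cM t i : E t -> (c t i < M)%N.
  move=> [/(_ (val i))/=]; rewrite rV_of_tupleE => /andP[tr1 tr2] _.
  rewrite /c truncn_lt_nat ?ME; last lra.
  lra.
have EB : E `<=` \big[setU/set0]_(k < #|{ffun T -> 'I_M}|)
    B_ (nth g0 (enum {ffun T -> 'I_M}) k).
  move=> t Et.
  pose g : {ffun T -> 'I_M} := [ffun i => Ordinal (cM t i Et)].
  have Egt : E_ g t by split => //= i; rewrite ffunE.
  have [Eg_ ctg] : E_ g (t_ g) by apply: xgetPex; exists t.
  rewrite -(bigcup_mkord _ (fun k => B_ (nth g0 (enum {ffun T -> 'I_M}) k))).
  exists (index g (enum {ffun T -> 'I_M})) => /=.
    by rewrite cardE index_mem mem_enum.
  rewrite nth_index ?mem_enum// => i.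
  rewrite -ler_distlC -[X in `|X| <= _]opprK normrN opprB.
  suff : forall i, `|(rV_of_tuple t - rV_of_tuple (t_ g)) 0 i| <= K.
    by move/(_ i); rewrite !mxE.
  apply: piK => {i}[i iI|a].
    have := cE _ (exist _ i iI) Et; have := cE _ (exist _ i iI) Eg_.
    have := ctg (exist _ i iI); rewrite /= ffunE /= => ->.
    rewrite !mxE -natr1 => /andP[? ?] /andP[? ?].
    by rewrite ler_norml; apply/andP; split; lra.
  have [_ /(_ a)/andP[? ?]] := Et; have [_ /(_ a)/andP[? ?]] := Eg_.
  rewrite linearB 2!mxE ler_norml; apply/andP; split; lra.
have mB (k : nat) := lebesgue_tuple_closed_box
  (tnth (t_ (nth g0 (enum {ffun T -> 'I_M}) k))) K0.
apply: (le_trans (@content_subadditive _ _ _ (lebesgue_tuple R n) E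
  (fun k => B_ (nth g0 (enum {ffun T -> 'I_M}) k)) _ _ _ EB)).
- by move=> k _; exact: (mB k).1.
- apply: measurableI; [exact: measurable_centered_cube|].
  exact: measurable_preimage_unit_cube.
rewrite (eq_bigr (fun=> ((2 * K) ^+ n)%:E)) => [|k _]; last exact: (mB k).2.
rewrite sumEFin sumr_const card_ord card_ffun card_ord.
have -> : #|{: T}| = (n - d)%N.
  rewrite card_sig -[in RHS](card_ord n) -(cardC (mem (codom I))).
  by rewrite card_codom// card_ord addKn.
rewrite lee_fin -[X in X <= _]mulr_natr -mulrA ler_wpM2l ?exprn_ge0 ?mulr_ge0//.
rewrite natrX -exprMn lerXn2r ?nnegrE ?mulr_ge0//; first lra.
rewrite ME /N -natr1.
have : (Num.truncn r)%:R <= r by rewrite truncn_le; lra.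
lra.
Qed.

(** * Weights *)

(** With S the logarithm of the left side, the tangent line of the exponential
    at S gives a_i >= e^S (1 + ln a_i - S) and 1 >= e^S (1 - S). The combination
    with weights q_i and 1 - sum q is the claim. *)
Lemma weighted_AMGM (R : realType) (I : finType) (q a : I -> R) :
  (forall i, 0 <= q i) -> \sum_i q i <= 1 -> (forall i, 0 <= a i) ->
  \prod_i a i `^ q i <= \sum_i q i * a i + (1 - \sum_i q i).
Proof.
move=> q0 q1 a0.
have rhs0 : 0 <= \sum_i q i * a i + (1 - \sum_i q i).
  by rewrite addr_ge0 ?subr_ge0// sumr_ge0// => i _; rewrite mulr_ge0.
(* A vanishing a_i with a positive weight kills the product; otherwise all
   logarithms with nonzero weight are genuine. *)
have [/existsP[i /andP[/eqP ai qi]]|/existsPn nz] :=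
    boolP [exists i, (a i == 0) && (q i != 0)].
  by rewrite (bigD1 i)//= ai powR0// mul0r.
pose S := \sum_i q i * ln (a i).
have -> : \prod_i a i `^ q i = expR S.
  rewrite expR_sum; apply: eq_bigr => i _; rewrite /powR.
  have := nz i; case: eqP => //= _; rewrite negbK => /eqP ->.
  by rewrite mul0r expR0 eqxx.
have tangent i : q i * (expR S * (1 + ln (a i) - S)) <= q i * a i.
  have := nz i; have [-> _|ai _] := eqVneq (q i) 0; first by rewrite !mul0r.
  have {}ai : 0 < a i by move: (nz i); rewrite ai andbT lt0r a0 => ->.
  rewrite ler_wpM2l// -{2}[a i]lnK ?posrE//.
  have -> : expR (ln (a i)) = expR S * expR (ln (a i) - S).
    by rewrite -expRD subrKC.
  by rewrite ler_wpM2l ?expR_ge0// -addrA expR_ge1Dx.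
have tangent1 : expR S * (1 - S) <= 1.
  rewrite -[leRHS](expRxMexpNx_1 S) ler_wpM2l ?expR_ge0//.
  by rewrite expR_ge1Dx.
have : \sum_i q i * (expR S * (1 + ln (a i) - S)) <= \sum_i q i * a i.
  exact: ler_sum.
have -> : \sum_i q i * (expR S * (1 + ln (a i) - S)) =
    expR S * ((\sum_i q i) * (1 - S) + S).
  rewrite /S mulr_suml -big_split/= mulr_sumr; apply: eq_bigr => i _.
  by rewrite -/S; ring.
have : (1 - \sum_i q i) * (expR S * (1 - S)) <= (1 - \sum_i q i) * 1.
  by rewrite ler_wpM2l ?subr_ge0.
lra.
Qed.

(** Run through the levels d i = k from the top, keeping the mass p until the
    total reaches 1. On level k this keeps the proportion of the mass s k - s k.+1
    by which min(1, s) increases there, so all weights of a level are scaled by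
    the same factor. *)
Lemma truncated_weights (R : realType) (I : finType) (p : I -> R)
    (d : I -> nat) : (forall i, 0 <= p i) ->
  exists q : I -> R, (forall i, 0 <= q i <= p i) /\
    forall k, \sum_(i | (k <= d i)%N) q i =
              Num.min 1 (\sum_(i | (k <= d i)%N) p i).
Proof.
move=> p0; pose s k := \sum_(i | (k <= d i)%N) p i.
have level (F : I -> R) k : \sum_(i | (k <= d i)%N) F i =
    \sum_(i | d i == k) F i + \sum_(i | (k < d i)%N) F i.
  rewrite (bigID (fun i => d i == k))/=; congr (_ + _); apply: eq_bigl => i.
    by case: eqP => [->|]; rewrite ?leqnn ?andbF.
  by rewrite ltn_neqAle andbC eq_sym.
have lev0 k : 0 <= \sum_(i | d i == k) p i by exact: sumr_ge0.
have sS k : s k - s k.+1 = \sum_(i | d i == k) p i by rewrite /s level addrK.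
pose m k := Num.min 1 (s k) - Num.min 1 (s k.+1).
have m01 k : 0 <= m k <= s k - s k.+1.
  have := lev0 k; rewrite -sS /m.
  by case: (lerP 1 (s k)) => ?; case: (lerP 1 (s k.+1)) => ?; lra.
(* On a level without mass the quotient is x / 0 = 0, and p i vanishes as well. *)
pose q i := p i * (m (d i) / (s (d i) - s (d i).+1)).
exists q; split=> [i|k].
  have /andP[mi0 mi1] := m01 (d i).
  have s0 : 0 <= s (d i) - s (d i).+1 by rewrite sS.
  rewrite mulr_ge0 ?divr_ge0//= -[leRHS]mulr1 ler_wpM2l//.
  have [e|ne] := eqVneq (s (d i) - s (d i).+1) 0; first by rewrite e invr0 mulr0.
  by rewrite ler_pdivrMr ?mul1r// lt0r ne.
have qlev j : \sum_(i | d i == j) q i = m j.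
  rewrite (eq_bigr (fun i => p i * (m j / (s j - s j.+1)))); last first.
    by move=> i /eqP <-.
  rewrite -mulr_suml -sS.
  have [e|ne] := eqVneq (s j - s j.+1) 0; last by rewrite mulrC divfK.
  by have := m01 j; rewrite e mul0r -eq_le => /eqP.
(* Downward induction on the level, starting above the maximum of d. *)
have [D kD] := ubnP ((\max_i d i).+1 - k)%N.
elim: D k kD => // D IH k kD; rewrite -/(s k).
have [kd|dk] := ltnP k (\max_i d i).+1; last first.
  have nok i : (k <= d i)%N = false.
    by apply/negbTE; rewrite -ltnNge (leq_trans _ dk)// ltnS leq_bigmax.
  by rewrite /s !big_pred0// min_r.
rewrite level qlev IH; last exact: leq_trans (ltn_sub2l kd _) kD.
by rewrite /m -/(s k.+1) subrK.
Qed.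

(** Summing the truncated masses over the levels 1, ..., n counts each q i
    exactly d i times, which makes the exponent linear in q. *)
Lemma BL_weights (R : realType) (I : finType) (p : I -> R) (n : nat)
    (d : I -> nat) : (forall i, 0 <= p i) -> (forall i, (d i <= n)%N) ->
  exists q : I -> R, [/\ forall i, 0 <= q i <= p i, \sum_i q i <= 1 &
    \sum_(1 <= k < n.+1) Num.max (1 - \sum_(i | (k <= d i)%N) p i) 0 =
    n%:R - \sum_i q i * (d i)%:R].
Proof.
move=> p0 dn; have [q [q01 qE]] := truncated_weights d p0.
exists q; split=> //; first by have := qE 0%N => /= ->; rewrite ge_min lexx.
have -> : \sum_i q i * (d i)%:R =
    \sum_(1 <= k < n.+1) \sum_(i | (k <= d i)%N) q i.
  rewrite (exchange_big_dep xpredT)//=; apply: eq_bigr => i _.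
  transitivity (\sum_(1 <= k < (d i).+1) q i).
    by rewrite sumr_const_nat subn1 mulr_natr.
  by rewrite [LHS](big_nat_widen _ _ n.+1)//= ltnS.
rewrite (eq_bigr (fun k => 1 - \sum_(i | (k <= d i)%N) q i)) => [|k _].
  by rewrite sumrB sumr_const_nat subn1.
by rewrite qE; case: lerP => ?; case: lerP => ?; lra.
Qed.

(** * Functions constant on unit cubes *)

Lemma exists_unit_cube (R : realType) d (x : 'rV[R]_d) :
  exists v, unit_cube v x.
Proof.
by exists (\row_i Num.floor (x 0 i)) => i; rewrite mxE -intrD1 floor_itv.
Qed.

Lemma unit_cube_inj (R : realType) d (x : 'rV[R]_d) v w :
  unit_cube v x -> unit_cube w x -> v = w.
Proof.
move=> xv xw; apply/rowP => i.
have fl u : unit_cube u x -> Num.floor (x 0 i) = u 0 i.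
  by move=> /(_ i); rewrite -intrD1 => /floor_def.
by rewrite -(fl v)// -(fl w).
Qed.

Lemma BL_input_measurable (R : realType) d (f : 'rV[R]_d -> R) :
  BL_input f -> measurable_fun setT (f \o @rV_of_tuple R d).
Proof. by case=> /measurable_int/measurable_EFinP. Qed.

Lemma measurable_BL_input_comp (R : realType) n d (f : 'rV[R]_d -> R)
    (pi : {linear 'rV[R]_n -> 'rV[R]_d}) : BL_input f ->
  measurable_fun setT (fun t => f (pi (@rV_of_tuple R n t))).
Proof.
move=> fB; pose g t : d.-tuple (measurableTypeR R) :=
  [tuple pi (@rV_of_tuple R n t) 0 i | i < d].
rewrite (_ : (fun _ => _) = (f \o @rV_of_tuple R d) \o g); last first.
  apply/funext => t /=; congr f; apply/rowP => i.
  by rewrite rV_of_tupleE tnth_mktuple.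
apply: measurableT_comp; first exact: BL_input_measurable.
apply/measurable_fun_tnthP => i.
rewrite (_ : _ \o _ = fun t => pi (@rV_of_tuple R n t) 0 i).
  exact: measurable_linear_coord.
by apply/funext => t /=; rewrite tnth_mktuple.
Qed.

Lemma BL_input_integralE (R : realType) d (f : 'rV[R]_d -> R) : BL_input f ->
  (\int[lebesgue_tuple R d]_t (f (rV_of_tuple t))%:E)%E =
  (\int[lebesgue_tuple R d]_t f (rV_of_tuple t))%:E.
Proof.
by move=> [fi _ _ _]; rewrite /Rintegral fineK//; exact: integrable_fin_num fi.
Qed.

Lemma integral_unit_cube (R : realType) d (f : 'rV[R]_d -> R) v x :
  cube_constant f -> unit_cube v x ->
  (\int[lebesgue_tuple R d]_(t in @rV_of_tuple R d @^-1` unit_cube v)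
     (f (rV_of_tuple t))%:E)%E = (f x)%:E.
Proof.
move=> fc vx; rewrite (eq_integral (cst (f x)%:E)).
  apply: etrans (integral_cst _ _ _) _.
    exact: (measurable_preimage_unit_cube idfun).
  by rewrite [X in (_ * X)%E](lebesgue_tuple_unit_cube R v) mule1.
by move=> t /set_mem tv; congr EFin; exact: fc tv vx.
Qed.

(** A unit cube has measure 1, so the value on it is the integral over it. *)
Lemma BL_input_le_integral (R : realType) d (f : 'rV[R]_d -> R) x :
  BL_input f -> f x <= \int[lebesgue_tuple R d]_t f (rV_of_tuple t).
Proof.
move=> fB; have [_ f0 _ fc] := fB; have [v vx] := exists_unit_cube x.
rewrite -lee_fin -BL_input_integralE// -(integral_unit_cube fc vx).
apply: ge0_subset_integral => //.
- exact: (measurable_preimage_unit_cube idfun).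
- by apply/measurable_EFinP; exact: BL_input_measurable.
- by move=> t _; rewrite lee_fin.
Qed.

Lemma BL_input_integral_gt0 (R : realType) d (f : 'rV[R]_d -> R) :
  BL_input f -> 0 < \int[lebesgue_tuple R d]_t f (rV_of_tuple t).
Proof.
move=> fB; have [_ f0 [x fx] _] := fB.
by apply: lt_le_trans (BL_input_le_integral x fB); rewrite lt0r fx f0.
Qed.

(** Both integrals split over the unit cubes v, on which f is constant: the
    same value of f multiplies the measure of the preimage of v on the left and
    that of v, which is 1, on the right. *)
Lemma integral_cube_constant_le (R : realType) n d (f : 'rV[R]_d -> R)
    (pi : {linear 'rV[R]_n -> 'rV[R]_d}) (D : set 'rV[R]_n) (K : R) :
  BL_input f -> measurable (@rV_of_tuple R n @^-1` D) ->
  (forall v, (lebesgue_tuple R n (@rV_of_tuple R n @^-1`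
     (D `&` (pi @^-1` unit_cube v))) <= K%:E)%E) ->
  (\int[lebesgue_tuple R n]_(t in @rV_of_tuple R n @^-1` D)
     (f (pi (rV_of_tuple t)))%:E <=
   (K * \int[lebesgue_tuple R d]_t f (rV_of_tuple t))%:E)%E.
Proof.
move=> fB mD DK; have [_ f0 _ fc] := fB.
(* Cubes are indexed by nat through an encoding of 'rV[int]_d; the indices that
   encode nothing give empty sets. *)
pose Q k : set 'rV[R]_d := if @pickle_inv 'rV[int]_d k is Some v
  then unit_cube v else set0.
have QT : \bigcup_k Q k = setT.
  apply/seteqP; split => // x _; have [v vx] := exists_unit_cube x.
  by exists (pickle v) => //; rewrite /Q pickleK_inv.
have Qinj k l x : Q k x -> Q l x -> k = l.
  rewrite /Q; have := @pickle_invK 'rV[int]_d k.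
  have := @pickle_invK 'rV[int]_d l.
  case: (pickle_inv _) => [v|] //= vl; case: (pickle_inv _) => [w|] //= wk xw xv.
  by rewrite -vl -wk (unit_cube_inj xv xw).
have mQ m (g : {linear 'rV[R]_m -> 'rV[R]_d}) k :
    measurable (@rV_of_tuple R m @^-1` (g @^-1` Q k)).
  rewrite /Q; case: (pickle_inv _) => [v|]; last by rewrite !preimage_set0.
  exact: measurable_preimage_unit_cube.
rewrite EFinM -BL_input_integralE//.
have unit_cube_center v : unit_cube v (\row_i (v 0 i)%:~R : 'rV[R]_d).
  by move=> i; rewrite mxE lexx ltrDl ltr01.
have DE : @rV_of_tuple R n @^-1` D =
    \bigcup_k (@rV_of_tuple R n @^-1` (D `&` (pi @^-1` Q k))).
  by rewrite -preimage_bigcup -setI_bigcupr -preimage_bigcup QT preimage_setT setIT.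
have TE : [set: d.-tuple (measurableTypeR R)] =
    \bigcup_k (@rV_of_tuple R d @^-1` Q k).
  by rewrite -preimage_bigcup QT preimage_setT.
have mf := BL_input_measurable fB.
have mpi := measurable_BL_input_comp pi fB.
rewrite {1}DE TE !ge0_integral_bigcup//=.
- rewrite -nneseriesZl; last first.
    by move=> k _; apply: integral_ge0 => t _; rewrite lee_fin.
  apply: lee_nneseries => [k _ _|k _].
    by apply: integral_ge0 => t _; rewrite lee_fin.
  rewrite /Q; case: (pickle_inv _) => [v|]; last first.
    by rewrite preimage_set0 setI0 !preimage_set0 !integral_set0 mule0.
  rewrite (integral_unit_cube fc (unit_cube_center v)).
  rewrite (eq_integral (cst (f (\row_i (v 0 i)%:~R))%:E)); last first.
    by move=> t /set_mem[_ tv]; congr EFin; exact: fc tv (unit_cube_center v).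
  rewrite muleC; apply: le_trans (lee_wpmul2l _ (DK v)); last by rewrite lee_fin.
  rewrite le_eqVlt; apply/orP; left; apply/eqP; apply: integral_cst.
  by apply: measurableI => //; exact: measurable_preimage_unit_cube.
- exact: mQ _ idfun.
- by rewrite -TE; apply/measurable_EFinP.
- by move=> t _; rewrite lee_fin.
- by move=> k l _ _ [t [/= tk tl]]; exact: Qinj tk tl.
- by move=> k; apply: measurableI => //; exact: mQ.
- by rewrite -DE; apply/measurable_EFinP; exact: measurable_funS mpi.
- by move=> t _; rewrite lee_fin.
- by move=> k l _ _ [t [/= [_ tk] [_ tl]]]; exact: Qinj tk tl.
Qed.

(** * The Brascamp-Lieb estimate *)

(** The two constants are packed in a pair so that they can be chosen for all
    indices j at once. *)
Lemma cube_integral_projection_le (R : realType) n d (V0 : 'M[R]_n) :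
  (n - \rank V0)%N = d ->
  exists nuC : R * R, [/\ 0 < nuC.1, 0 <= nuC.2 &
    forall V (pi : {linear 'rV[R]_n -> 'rV[R]_d}) (r : R) f,
      subspace_dist V V0 <= nuC.1 ->
      orthogonal_projection_onto (orthocomp V) pi ->
      1 <= r -> BL_input f ->
      (\int[lebesgue_tuple R n]_(t in @rV_of_tuple R n @^-1` centered_cube r)
         (f (pi (rV_of_tuple t)))%:E <=
       (nuC.2 * r ^+ (n - d) *
          \int[lebesgue_tuple R d]_t f (rV_of_tuple t))%:E)%E].
Proof.
move=> dE; have [I [nu [K [Iinj nu0 K0 ctrl]]]] := projection_controls_coords dE.
exists (nu, (2 * K) ^+ n * 4 ^+ (n - d)); split=> //=.
  by rewrite mulr_ge0// exprn_ge0// mulr_ge0.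
move=> V pi r f VV0 piV r1 fB.
apply: integral_cube_constant_le => //; first exact: measurable_centered_cube.
move=> v; apply: lebesgue_tuple_cube_preimage_le Iinj K0 _ _ _ r1.
exact: ctrl VV0 piV.
Qed.

Lemma powR_le1_antitone (R : realType) (u q p : R) :
  0 <= u <= 1 -> 0 <= q <= p -> u `^ p <= u `^ q.
Proof.
move=> /andP[u0 u1] /andP[q0 qp].
have [->|un0] := eqVneq u 0.
  have [p0|pn0] := eqVneq p 0; last by rewrite powR0// powR_ge0.
  by have -> : q = p by lra.
rewrite /powR (negbTE un0) ler_expR ler_wnM2r// -ln1 ler_ln ?posrE//.
by rewrite lt0r un0.
Qed.

Lemma powR_sum (R : realType) (I : finType) (r : R) (s : I -> R) : 0 < r ->
  \prod_i r `^ s i = r `^ (\sum_i s i).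
Proof.
move=> r0; rewrite /powR gt_eqF// mulr_suml expR_sum.
by apply: eq_bigr => i _.
Qed.

Lemma lebesgue_tuple_centered_cube (R : realType) n (r : R) : 0 <= r ->
  lebesgue_tuple R n (@rV_of_tuple R n @^-1` centered_cube r) =
  ((2 * r) ^+ n)%:E.
Proof.
move=> r0; rewrite -(lebesgue_tuple_closed_box (fun=> 0) r0).2.
congr (lebesgue_tuple R n _).
by apply/seteqP; split=> t tA i; have := tA i; rewrite !mxE sub0r add0r.
Qed.

(** Normalised by y_i <= F_i, the exponent p_i can be lowered to q_i. The factors
    r^(d i) are those that give every term r^(d i) y_i / F_i an integral of order
    r^n over the cube, the same as that of the constant 1. *)
Lemma BL_integrand_le (R : realType) (I : finType) (p q : I -> R)
    (d : I -> nat) (r : R) (F y : I -> R) :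
  0 < r -> (forall i, 0 <= q i <= p i) -> \sum_i q i <= 1 ->
  (forall i, 0 < F i) -> (forall i, 0 <= y i <= F i) ->
  \prod_i y i `^ p i <=
  (\prod_i F i `^ p i) * r `^ (- \sum_i q i * (d i)%:R) *
    (\sum_i q i * (r ^+ d i / F i) * y i + (1 - \sum_i q i)).
Proof.
move=> r0 qp q1 F0 yF.
have y0 i : 0 <= y i by case/andP: (yF i).
pose a i := r ^+ d i / F i * y i.
have a0 i : 0 <= a i by rewrite /a !mulr_ge0 ?invr_ge0 ?exprn_ge0 ?(ltW r0) ?(ltW (F0 i)).
have yE i : y i `^ p i <= F i `^ p i * (r `^ (- (q i * (d i)%:R)) * a i `^ q i).
  have yFi : 0 <= y i / F i <= 1.
    by case/andP: (yF i) => _ yFi; rewrite divr_ge0 ?(ltW (F0 i))//= ler_pdivrMr ?mul1r.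
  have -> : y i = F i * (y i / F i) by rewrite mulrC divfK ?gt_eqF.
  rewrite powRM ?(ltW (F0 i))//; last by case/andP: yFi.
  rewrite ler_wpM2l ?powR_ge0// (le_trans (powR_le1_antitone yFi (qp i)))//.
  have -> : a i = r `^ (d i)%:R * (y i / F i).
    by rewrite powR_mulrn ?(ltW r0)// /a; ring.
  rewrite [X in _ <= _ * X]powRM ?powR_ge0//; last by case/andP: yFi.
  rewrite -powRrM mulrA -powRD ?(gt_eqF r0) ?implybT// [(d i)%:R * _]mulrC addNr.
  by rewrite powRr0 mul1r.
apply: le_trans (_ : \prod_i (F i `^ p i * (r `^ (- (q i * (d i)%:R)) * a i `^ q i)) <= _).
  by apply: ler_prod => i _; rewrite powR_ge0 yE.
rewrite big_split/= big_split/= powR_sum// mulrA sumrN.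
rewrite ler_wpM2l ?mulr_ge0 ?prodr_ge0 ?powR_ge0//.
  by move=> i _; exact: powR_ge0.
rewrite (le_trans (weighted_AMGM _ q1 a0))//.
  by move=> i; case/andP: (qp i).
by rewrite lerD2r; apply: ler_sum => i _; rewrite /a mulrA.
Qed.

(** The Brascamp-Lieb bound follows from the case of a single map; the constant
    depends on the maps only through those of the single-map estimates. *)
Lemma regularized_BL_le (R : realType) n J (m : 'I_J -> nat)
    (pi : forall j : 'I_J, {linear 'rV[R]_n -> 'rV[R]_(m j)})
    (p C : 'I_J -> R) (r : R) :
  1 <= r -> (forall j, 0 <= p j) -> (forall j, (m j <= n)%N) ->
  (forall j, 0 <= C j) ->
  (forall j f, BL_input f ->
    (\int[lebesgue_tuple R n]_(t in @rV_of_tuple R n @^-1` centered_cube r)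
       (f (pi j (rV_of_tuple t)))%:E <=
     (C j * r ^+ (n - m j) *
        \int[lebesgue_tuple R (m j)]_t f (rV_of_tuple t))%:E)%E) ->
  (regularized_BL pi p r <=
   ((\sum_j C j + 2 ^+ n) * r `^ (\sum_(1 <= k < n.+1)
       Num.max (1 - \sum_(j < J | (k <= m j)%N) p j) 0))%:E)%E.
Proof.
move=> r1 p0 mn C0 fibre.
have r0 : 0 < r by rewrite (lt_le_trans _ r1).
have [q [qp q1 ->]] := BL_weights p0 mn.
apply: ge_ereal_sup => _ [f fB <-].
pose F j := \int[lebesgue_tuple R (m j)]_t f j (rV_of_tuple t).
have F0 j : 0 < F j by exact: BL_input_integral_gt0.
have f0 j x : 0 <= f j x by case: (fB j).
have den0 : 0 < BL_den p f by apply: prodr_gt0 => j _; rewrite powR_gt0// F0.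
rewrite inver gt_eqF// lee_pdivrMr// -EFinM.
set Q := @rV_of_tuple R n @^-1` centered_cube r.
have mQ : measurable Q by exact: measurable_centered_cube.
set c := BL_den p f * r `^ (- \sum_j q j * (m j)%:R).
have c0 : 0 <= c by rewrite mulr_ge0 ?powR_ge0// ltW.
pose b j := q j * (r ^+ m j / F j).
have q0 j : 0 <= q j by case/andP: (qp j).
have b0 j : 0 <= b j.
  by rewrite mulr_ge0// divr_ge0 ?exprn_ge0 ?ltW.
have mfpi j : measurable_fun Q (fun t => f j (pi j (rV_of_tuple t))).
  by apply: measurable_funTS; exact: measurable_BL_input_comp.
have mbf j : measurable_fun Q
    (fun t => (b j)%:E * (f j (pi j (rV_of_tuple t)))%:E)%E.
  by apply: emeasurable_funM => //; apply/measurable_EFinP.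
have bf0 j t : (0 <= (b j)%:E * (f j (pi j (rV_of_tuple t)))%:E)%E.
  by rewrite mule_ge0 ?lee_fin.
pose g t : \bar R := (c%:E * (\sum_j
  ((b j)%:E * (f j (pi j (rV_of_tuple t)))%:E) + (1 - \sum_j q j)%:E))%E.
apply: (@le_trans _ _ (\int[lebesgue_tuple R n]_(t in Q) g t)%E).
  apply: ge0_le_integral => //.
  - by move=> t _; rewrite lee_fin prodr_ge0// => j _; exact: powR_ge0.
  - apply/measurable_EFinP; apply: measurable_prod => j _.
    by apply: (measurableT_comp (measurable_powR _)).
  - apply: emeasurable_funM => //; apply: emeasurable_funD => //.
    exact: emeasurable_sum.
  - move=> t _; have -> : g t = (c * (\sum_j b j * f j (pi j (rV_of_tuple t)) +
        (1 - \sum_j q j)))%:E by rewrite EFinM EFinD -sumEFin.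
    rewrite lee_fin; apply: BL_integrand_le => // j.
    by rewrite f0 BL_input_le_integral.
rewrite ge0_integralZl//; last 2 first.
- by apply: emeasurable_funD => //; exact: emeasurable_sum.
- by move=> t _; rewrite adde_ge0 ?sume_ge0// lee_fin subr_ge0.
rewrite ge0_integralD//; last 3 first.
- by move=> t _; rewrite sume_ge0.
- exact: emeasurable_sum.
- by move=> t _; rewrite lee_fin subr_ge0.
rewrite ge0_integral_sum//.
have -> : (\int[lebesgue_tuple R n]_(t in Q) (1 - \sum_j q j)%:E =
    ((1 - \sum_j q j) * (2 * r) ^+ n)%:E)%E.
  apply: etrans (integral_cst _ mQ _) _.
  by rewrite [X in (_ * X)%E](lebesgue_tuple_centered_cube n (ltW r0)).
have bfle j : (\int[lebesgue_tuple R n]_(t in Q)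
    ((b j)%:E * (f j (pi j (rV_of_tuple t)))%:E) <= (C j * r ^+ n)%:E)%E.
  rewrite ge0_integralZl//; last 3 first.
  - exact/measurable_EFinP.
  - by move=> t _; rewrite lee_fin.
  - by rewrite lee_fin.
  apply: le_trans (lee_wpmul2l _ (fibre j _ (fB j))) _; first by rewrite lee_fin.
  rewrite -EFinM lee_fin -/(F j) /b.
  have -> : q j * (r ^+ m j / F j) * (C j * r ^+ (n - m j) * F j) =
      q j * (C j * r ^+ n).
    rewrite -[in RHS](subnKC (mn j)) exprD; field; exact: lt0r_neq0.
  rewrite ler_piMl ?mulr_ge0 ?exprn_ge0 ?(ltW r0)//.
  rewrite (le_trans _ q1)// (bigD1 j)//= lerDl; exact: sumr_ge0.
apply: le_trans (lee_wpmul2l _ (leeD (lee_sum _ (fun j _ => bfle j)) (lexx _))) _.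
  by rewrite lee_fin.
rewrite sumEFin -EFinD -EFinM lee_fin /c -mulr_suml.
have -> : r `^ (n%:R - \sum_j q j * (m j)%:R) =
    r ^+ n * r `^ (- \sum_j q j * (m j)%:R).
  by rewrite powRD ?(gt_eqF r0) ?implybT// powR_mulrn ?(ltW r0).
rewrite exprMn.
set G := r `^ (- _); set D := BL_den p f.
have G0 : 0 <= G by exact: powR_ge0.
have S0 : 0 <= \sum_j q j by exact: sumr_ge0.
have -> : (\sum_j C j + 2 ^+ n) * (r ^+ n * G) * D =
  D * G * ((\sum_j C j) * r ^+ n + 2 ^+ n * r ^+ n) by ring.
rewrite ler_wpM2l ?mulr_ge0 ?(ltW den0)// lerD2l ler_piMl//.
  by rewrite mulr_ge0 ?exprn_ge0 ?(ltW r0).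
lra.
Qed.

Theorem theorem3 (R : realType) (n J : nat) (n_gt0 : (1 <= n)%N)
    (J_gt0 : (1 <= J)%N)
    (p : 'I_J -> R) (p01 : forall j, 0 <= p j <= 1)
    (n' : 'I_J -> nat) (nj_ge1 : forall j, (1 <= n - n' j <= n)%N)
    (V0 : 'I_J -> 'M[R]_n) (V0_dim : forall j, \rank (V0 j) = n' j) :
  exists nu C0 : R,
    [/\ 0 < nu, 0 < C0 &
      forall (r : R) (V : 'I_J -> 'M[R]_n)
             (pi : forall j : 'I_J, {linear 'rV[R]_n -> 'rV[R]_(n - n' j)%N}),
        1 <= r ->
        (forall j, \rank (V j) = n' j) ->
        (forall j, subspace_dist (V j) (V0 j) <= nu) ->
        (forall j, orthogonal_projection_onto (orthocomp (V j)) (pi j)) ->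
        (regularized_BL pi p r <=
          (C0 * r `^ (\sum_(1 <= k < n.+1)
             Num.max (1 - \sum_(j < J | (k <= n - n' j)%N) p j) 0))%:E)%E].
Proof.
have /fin_all_exists[nuC nuCP] j := cube_integral_projection_le
  (congr1 (fun k => n - k)%N (V0_dim j)).
exists (\big[Num.min/1]_j (nuC j).1), (\sum_j (nuC j).2 + 2 ^+ n); split.
- by apply: lt_bigmin => // j _; case: (nuCP j).
- rewrite ltr_wpDl ?exprn_gt0// sumr_ge0// => j _; by case: (nuCP j).
- move=> r V pi r1 _ VV0 piV; apply: regularized_BL_le => //.
  + by move=> j; case/andP: (p01 j).
  + by move=> j; exact: leq_subr.
  + by move=> j; case: (nuCP j).
  + move=> j f fB; have [_ _ est] := nuCP j; apply: est (piV j) r1 fB.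
    by apply: le_trans (VV0 j) _; exact: bigmin_le_cond.
Qed.
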